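(* Let $N\ge1$, let $\lambda_1,\dots,\lambda_N\in\mathbb{C}$ be pairwise distinct, let $w\neq0$, let $\eta\in\mathbb{C}\setminus\{\lambda_1,\dots,\lambda_N\}$, and let $\ell_1,\dots,\ell_N$ be constants. Let $(y_i^{3},y_i^{\pm},z_i^{3},z_i^{\pm})_{i=1}^N$ (old variables) and $(\tilde y_i^{3},\tilde y_i^{\pm},\tilde z_i^{3},\tilde z_i^{\pm})_{i=1}^N$ (new variables) be complex numbers both satisfying the Casimir constraints with the same values $\ell_i$ and $1$, i.e. for every $i$ $$y^3_i z^3_i+\tfrac12(y^-_iz^+_i+y^+_iz^-_i)=\ell_i,\qquad (z_i^3)^2+z_i^-z_i^+=1,$$ and the same equations with tildes on all variables. Assume $z_i^-\neq0$, $\tilde z_i^+\neq0$ and $1+(\eta-\lambda_i)z_i^-\tilde z_i^+\neq0$ for all $i$. Then the one-point Bäcklund transformation of the rational Lagrange chain (old variables $\mapsto$ new variables, defined in the context by the intertwining relation $\mathcal{M}(\lambda;\eta)\mathcal{L}(\lambda)=\tilde{\mathcal{L}}(\lambda)\mathcal{M}(\lambda;\eta)$) is defined by the generating function $$F_\eta(\mathbf{z}^-,\mathbf{y}^-\mid\tilde{\mathbf{z}}^+,\tilde{\mathbf{y}}^+)=-\frac{\mathrm{i}}{2w}\sum_{i,j=1}^{N}y_i^-\tilde y_j^+-\mathrm{i}\sum_{i=1}^{N}k_i\left(\frac{y_i^-}{z_i^-}+\frac{\tilde y_i^+}{\tilde z_i^+}-\frac{1}{\eta-\lambda_i}\right)+\mathrm{i}\log\prod_{i=1}^{N}\left(\frac{1+k_i}{1-k_i}\right)^{\ell_i}-\mathrm{i}\,w\,N\,\eta,$$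 where $$k_i^2=1+(\eta-\lambda_i)\,z_i^-\,\tilde z_i^+ .$$ That is, the old and new variables are related by the one-point Bäcklund transformation with parameter $\eta$ if and only if, for some choice of the square roots $k_1,\dots,k_N$, the following equations hold for all $i=1,\dots,N$: $$z_i^3=\mathrm{i}\,z_i^-\,\frac{\partial F_\eta}{\partial y_i^-},\qquad y_i^3=\mathrm{i}\,z_i^-\,\frac{\partial F_\eta}{\partial z_i^-}+\mathrm{i}\,y_i^-\,\frac{\partial F_\eta}{\partial y_i^-},$$ $$\tilde z_i^3=\mathrm{i}\,\tilde z_i^+\,\frac{\partial F_\eta}{\partial\tilde y_i^+},\qquad \tilde y_i^3=\mathrm{i}\,\tilde z_i^+\,\frac{\partial F_\eta}{\partial\tilde z_i^+}+\mathrm{i}\,\tilde y_i^+\,\frac{\partial F_\eta}{\partial\tilde y_i^+}.$$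
   Context: The Lax matrix of the rational Lagrange chain is $$\mathcal{L}(\lambda)=\mathcal{W}+\sum_{i=1}^N\left[\frac{\mathcal{Y}_i}{\lambda-\lambda_i}+\frac{\mathcal{Z}_i}{(\lambda-\lambda_i)^2}\right],$$ $$\mathcal{W}=\frac{\mathrm{i}w}{2}\begin{pmatrix} 1 & 0 \\ 0 & -1 \end{pmatrix},\quad \mathcal{Y}_i=\frac{\mathrm{i}}{2}\begin{pmatrix} y_i^3 & y_i^- \\ {y_i^+} & -y_i^3 \end{pmatrix},\quad \mathcal{Z}_i=\frac{\mathrm{i}}{2}\begin{pmatrix} z_i^3 & z_i^- \\ {z_i^+} & -z_i^3 \end{pmatrix},$$ where, in terms of the generators $y_i^\alpha,z_i^\alpha$ ($\alpha=1,2,3$) of the $i$-th copy of $\mathfrak{e}(3)$, $y_i^\pm=y_i^1\pm\mathrm{i}y_i^2$ and $z_i^\pm=z_i^1\pm\mathrm{i}z_i^2$. $\tilde{\mathcal{L}}(\lambda)$ is the same expression with the same $w$ and $\lambda_i$ and with all variables $y_i^\bullet,z_i^\bullet$ replaced by $\tilde y_i^\bullet,\tilde z_i^\bullet$. The transformation is complex, so all variables are complex and $y_i^+,y_i^-$ (likewise $z_i^+,z_i^-$) are treated as independent. One-point Bäcklund transformation with parameter $\eta$: old and new variables (both satisfying the Casimir constraints with the same values) are related by it if there are $p,q\in\mathbb{C}$ such that, with $$\mathcal{M}(\lambda;\eta)=\begin{pmatrix} \lambda-\eta+pq & p \\ {q} & 1 \end{pmatrix},\qquad \det\mathcal{M}(\lambda;\eta)=\lambda-\eta,$$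 one has $\mathcal{M}(\lambda;\eta)\,\mathcal{L}(\lambda)=\tilde{\mathcal{L}}(\lambda)\,\mathcal{M}(\lambda;\eta)$ for all $\lambda\in\mathbb{C}\setminus\{\lambda_1,\dots,\lambda_N\}$. Notation: $\mathbf{y}^\alpha=(y_1^\alpha,\dots,y_N^\alpha)$, $\mathbf{z}^\alpha=(z_1^\alpha,\dots,z_N^\alpha)$ for $\alpha=\pm,3$, and similarly with tildes. $F_\eta$ is a function of the $4N$ independent variables $\mathbf{z}^-,\mathbf{y}^-,\tilde{\mathbf{z}}^+,\tilde{\mathbf{y}}^+$; partial derivatives are taken with the others (and $\eta$, $w$, $\ell_i$, $\lambda_i$) fixed, $k_i$ being a local holomorphic branch of the square root, hence a function of $z_i^-$ and $\tilde z_i^+$. The logarithm term means $\mathrm{i}\sum_i\ell_i\log\frac{1+k_i}{1-k_i}$ with any local branch; its derivatives do not depend on the branch. *)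

(* Defs.v *)
From HB Require Import structures.
From mathcomp Require Import all_boot all_order all_algebra complex.
From mathcomp Require Import boolp classical_sets reals topology normedtype.
From mathcomp Require Import sequences derive exp trigo.

Set Implicit Arguments.
Unset Strict Implicit.
Unset Printing Implicit Defensive.

Import Order.TTheory GRing.Theory Num.Theory numFieldNormedType.Exports.

Local Open Scope ring_scope.

(* R[i] packed as a numClosedFieldType: in this form it inherits the
   topological and normed structures of a numeric field over itself, so that
   [derivable] and [derive1] below are complex differentiability and the
   complex derivative. *)
Definition Cplx (R : realType) : numClosedFieldType := R[i]%C.

Definition cexp (R : realType) (z : Cplx R) : Cplx R :=
  (expR (complex.Re z) * cos (complex.Im z)
     +i* (expR (complex.Re z) * sin (complex.Im z)))%C.

Definition sqrt_branch (R : realType) (s : Cplx R -> Cplx R) (a : Cplx R) :=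
  \forall x \near a, derivable s x 1 /\ s x ^+ 2 = x.

Definition log_branch (R : realType) (l : Cplx R -> Cplx R) (a : Cplx R) :=
  \forall x \near a, derivable l x 1 /\ cexp (l x) = x.

(* Partial derivative with respect to the coordinate x_i. *)
Definition partial (R : realType) (N : nat) (f : ('I_N -> Cplx R) -> Cplx R)
    (x : 'I_N -> Cplx R) (i : 'I_N) : Cplx R :=
  derive1 (fun t : Cplx R => f [eta x with i |-> t]) (x i).

(* The suffixes 3, m, p stand for the superscripts 3, -, +. All variables are
   complex, so x^+ and x^- are independent and are taken as coordinates in
   place of x^1 and x^2. *)
Record chain_vars (R : realType) (N : nat) := ChainVars {
  y3 : 'I_N -> Cplx R; ym : 'I_N -> Cplx R; yp : 'I_N -> Cplx R;
  z3 : 'I_N -> Cplx R; zm : 'I_N -> Cplx R; zp : 'I_N -> Cplx R }.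

Definition casimir (R : realType) (N : nat) (ell : 'I_N -> Cplx R)
    (v : chain_vars R N) : Prop :=
  forall i,
    y3 v i * z3 v i + 2^-1 * (ym v i * zp v i + yp v i * zm v i) = ell i
    /\ z3 v i ^+ 2 + zm v i * zp v i = 1.

Definition mx2 (R : realType) (a b c d : Cplx R) : 'M[Cplx R]_2 :=
  \matrix_(i < 2, j < 2) nth 0 (nth [::] [:: [:: a; b]; [:: c; d]] i) j.

Definition residue_mx (R : realType) (x3 xm xp : Cplx R) : 'M[Cplx R]_2 :=
  ('i / 2) *: mx2 x3 xm xp (- x3).

Definition lax (R : realType) (N : nat) (w : Cplx R) (lambda : 'I_N -> Cplx R)
    (v : chain_vars R N) (x : Cplx R) : 'M[Cplx R]_2 :=
  ('i * w / 2) *: mx2 1 0 0 (- 1)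
  + \sum_(i < N) ((x - lambda i)^-1 *: residue_mx (y3 v i) (ym v i) (yp v i)
      + ((x - lambda i) ^+ 2)^-1 *: residue_mx (z3 v i) (zm v i) (zp v i)).

Definition darboux (R : realType) (eta p q x : Cplx R) : 'M[Cplx R]_2 :=
  mx2 (x - eta + p * q) p q 1.

Definition backlund (R : realType) (N : nat) (w : Cplx R)
    (lambda : 'I_N -> Cplx R) (eta : Cplx R) (v v' : chain_vars R N) : Prop :=
  exists p q : Cplx R, forall x : Cplx R, (forall i, x != lambda i) ->
    darboux eta p q x *m lax w lambda v x
    = lax w lambda v' x *m darboux eta p q x.

Definition k_arg (R : realType) (N : nat) (lambda : 'I_N -> Cplx R)
    (eta : Cplx R) (zm zp' : 'I_N -> Cplx R) (i : 'I_N) : Cplx R :=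
  1 + (eta - lambda i) * zm i * zp' i.

(* s i and l i are the branches of the square root and of the logarithm used
   at the site i, so that k_i = s i (k_arg i). *)
Definition gen_fun (R : realType) (N : nat) (w : Cplx R)
    (lambda : 'I_N -> Cplx R) (eta : Cplx R) (ell : 'I_N -> Cplx R)
    (s l : 'I_N -> Cplx R -> Cplx R)
    (zm ym zp' yp' : 'I_N -> Cplx R) : Cplx R :=
  let k i := s i (k_arg lambda eta zm zp' i) in
  - ('i / (2 * w)) * (\sum_(i < N) \sum_(j < N) ym i * yp' j)
  - 'i * (\sum_(i < N)
            k i * (ym i / zm i + yp' i / zp' i - (eta - lambda i)^-1))
  + 'i * (\sum_(i < N) ell i * l i ((1 + k i) / (1 - k i)))
  - 'i * w * N%:R * eta.

Definition generated_by (R : realType) (N : nat)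
    (F : ('I_N -> Cplx R) -> ('I_N -> Cplx R) ->
         ('I_N -> Cplx R) -> ('I_N -> Cplx R) -> Cplx R)
    (v v' : chain_vars R N) : Prop :=
  let dzm := partial (fun u => F u (ym v) (zp v') (yp v')) (zm v) in
  let dym := partial (fun u => F (zm v) u (zp v') (yp v')) (ym v) in
  let dzp' := partial (fun u => F (zm v) (ym v) u (yp v')) (zp v') in
  let dyp' := partial (fun u => F (zm v) (ym v) (zp v') u) (yp v') in
  forall i : 'I_N,
    [/\ z3 v i = 'i * zm v i * dym i,
        y3 v i = 'i * zm v i * dzm i + 'i * ym v i * dym i,
        z3 v' i = 'i * zp v' i * dyp' i
      & y3 v' i = 'i * zp v' i * dzp' i + 'i * yp v' i * dyp' i].

(* Main.v *)
Require Import Defs.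
From HB Require Import structures.
From mathcomp Require Import all_boot all_order all_algebra complex.
From mathcomp Require Import boolp classical_sets functions reals topology normedtype.
From mathcomp Require Import sequences derive exp trigo.
From mathcomp Require Import ring.

Set Implicit Arguments.
Unset Strict Implicit.
Unset Printing Implicit Defensive.

Import Order.TTheory GRing.Theory Num.Theory numFieldNormedType.Exports.

Local Open Scope classical_set_scope.
Local Open Scope ring_scope.

(** Comparing principal parts at the poles and at infinity, the intertwining
    relation fixes p = (sum y_i^-) / 2w and q = (sum y~_i^+) / 2w and leaves
    six equations per site. Two of them say that k = z3 - q z^- = z~3 - p z~^+
    and c = y3 - q y^- = y~3 - p y~^+; modulo the Casimir constraints the
    others amount to k^2 = 1 + d z^- z~^+ and
    2kc = 2 ell + d (y^- z~^+ + y~^+ z^-) - z^- z~^+, where d = eta - lambda_i.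
    Since d/dk log ((1 + k) / (1 - k)) = 2 / (1 - k^2) = - 2 / (d z^- z~^+),
    these are the equations generated by F_eta. The prescribed value k is
    reached by a holomorphic branch of the square root built from a branch of
    the complex logarithm, itself a continuous right inverse of the complex
    exponential. *)

(** * Derivatives through continuous slope functions, uniformly over real and complex scalars *)

Section Caratheodory.
Variable K : numFieldType.
Implicit Types (f g : K -> K) (x a b : K).

Lemma is_derive1_cvgP f x a :
  is_derive x 1 f a <-> (fun h => h^-1 * (f (h + x) - f x)) @ 0^' --> a.
Proof.
have -> : (fun h => h^-1 * (f (h + x) - f x)) =
    (fun h => h^-1 *: ((f \o shift x) (h *: 1) - f x)).
  by apply/funext => h; rewrite /= [h *: 1]mulr1.
split=> [[df <-]|dfa]; first exact: df.
by split; [apply/cvg_ex; exists a | exact: cvg_lim].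
Unshelve. all: by end_near. Qed.

(** The witness is the difference quotient, completed by the value [a] at [x]. With it, the rules
    for composites and inverses become algebraic identities between slopes together with continuity
    at one point, and the same proofs serve [R] and [Cplx R]. *)
Lemma caratheodoryP f x a : is_derive x 1 f a <->
  exists g, [/\ forall z, f z - f x = g z * (z - x),
                {for x, continuous g} & g x = a].
Proof.
rewrite is_derive1_cvgP; split=> [dfa|[g [fE gx <-]]].
  exists (fun z => if z == x then a else (z - x)^-1 * (f z - f x)).
  rewrite eqxx; split=> // [z|].
    case: eqVneq => [->|zx]; first by rewrite !subrr mulr0.
    by rewrite mulrAC mulVf ?mul1r// subr_eq0.
  apply/continuous_withinNshiftx; rewrite eqxx.
  apply: cvg_trans dfa; apply: near_eq_cvg; rewrite near_withinE.
  near=> h => h0 /=.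
  by rewrite addrK ifN// -subr_eq0 addrK.
have/continuous_withinNshiftx := gx; apply: cvg_trans; apply: near_eq_cvg.
rewrite near_withinE; near=> h => h0 /=.
by rewrite fE addrK mulrC mulfK.
Unshelve. all: by end_near. Qed.

(** Slopes multiply: if [F] and [G] are slope functions of [f] at [g x] and of [g] at [x], then
    [F (g z) * G z] is one for the composite. *)
Lemma is_derive1_comp_num f g x a b :
  is_derive (g x) 1 f a -> is_derive x 1 g b -> is_derive x 1 (f \o g) (a * b).
Proof.
move=> df dg; have gx : {for x, continuous g}.
  by apply/differentiable_continuous/derivable1_diffP; case: dg.
move/caratheodoryP: df => [F [fE Fc <-]]; move/caratheodoryP: dg => [G [gE Gc <-]].
apply/caratheodoryP; exists (fun z => F (g z) * G z); split=> // [z|].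
  by rewrite /= fE gE mulrA.
by apply: continuousM => //; apply: continuous_comp.
Unshelve. all: by end_near. Qed.

Lemma is_derive_mulr x a : is_derive x 1 (fun y => y * a) a.
Proof.
apply/caratheodoryP; exists (fun=> a); split=> // [z|]; last exact: cst_continuous.
by rewrite -mulrBl mulrC.
Qed.

Lemma is_derive_affine x a b : is_derive x 1 (fun y => b + y * a) a.
Proof.
by apply/caratheodoryP; exists (fun=> a); split=> // [z|];
  [ring | exact: cst_continuous].
Qed.

Lemma is_deriveM_num f g x a b : is_derive x 1 f a -> is_derive x 1 g b ->
  is_derive x 1 (fun y => f y * g y) (a * g x + f x * b).
Proof.
move=> df dg; apply: is_derive_eq (is_deriveM df dg) _.
by rewrite addrC [g x *: a]mulrC.
Qed.

Lemma is_deriveV_num f x a : f x != 0 -> is_derive x 1 f a ->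
  is_derive x 1 (fun y => (f y)^-1) (- a / f x ^+ 2).
Proof.
move=> fx0 [df <-]; split; first exact: derivableV.
by rewrite deriveV// /GRing.scale /= mulNr mulrC mulNr.
Unshelve. all: by end_near. Qed.

(** From y - x = f (g y) - f (g x) = F (g y) * (g y - g x), the slope of [g] near [x] is the inverse
    of [F (g y)], which is continuous at [x] because [F (g x) = a] is nonzero. Logarithms and square
    roots are differentiated in this way, as right inverses of the exponential and of squaring. *)
Lemma is_derive_right_inverse f g x a : {for x, continuous g} ->
  (\forall y \near x, f (g y) = y) ->
  is_derive (g x) 1 f a -> a != 0 -> is_derive x 1 g a^-1.
Proof.
move=> gx fg /caratheodoryP[F [fE Fc <-]] F0.
have Fgx : {for x, continuous (F \o g)} by apply: continuous_comp.
have FN0 : \forall y \near x, F (g y) != 0.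
  by apply: (cvgr_neq0 _ Fgx).
have Fgc : (F (g y))^-1 @[y --> x] --> (F (g x))^-1 by apply: (cvgV F0 Fgx).
have fgx : f (g x) = x by exact: nbhs_singleton fg.
apply/caratheodoryP.
exists (fun y => if y == x then (F (g x))^-1 else (g y - g x) / (y - x)).
rewrite eqxx; split=> // [z|].
  case: eqVneq => [->|zx]; first by rewrite !subrr mulr0.
  by rewrite divfK// subr_eq0.
rewrite /prop_for /continuous_at eqxx.
apply: cvg_trans Fgc; apply: (@near_eq_cvg _ _ (nbhs x)).
move: FN0 fg; apply: filter_app2; near=> y => Fgy fgy /=.
case: eqVneq => [->//|yx].
have := fE (g y); rewrite fgy fgx => yE.
have gyx : g y - g x != 0.
  by apply: contra_neq yx => gg; apply/eqP; rewrite -subr_eq0 yE gg mulr0.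
by rewrite yE invfM mulrCA divff// mulr1.
Unshelve. all: by end_near. Qed.

End Caratheodory.

(** * Holomorphic exponential, and branches of the logarithm and of the square root *)

Lemma near_dist_lt (K : numFieldType) (V : normedModType K) (x : V) (e : K) :
  0 < e -> \forall y \near x, `|x - y| < e.
Proof. by move=> e0; have /cvgrPdist_lt := @cvg_id _ (nbhs x); apply. Qed.

Section ComplexLog.
Variable R : realType.
Implicit Types (x y z : Cplx R) (a b : R).

Lemma complex_eq x y :
  complex.Re x = complex.Re y -> complex.Im x = complex.Im y -> x = y.
Proof. by case: x y => [x1 x2] [y1 y2] /= -> ->. Qed.

Lemma normc_ge_Im x : (`|complex.Im x|%:C)%C <= `|x|.
Proof.
by case: x => a b; rewrite normc_def /= lecR -sqrtr_sqr ler_wsqrtr// lerDr sqr_ge0.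
Qed.

Lemma norm_complexr a : `|(a%:C)%C : Cplx R| = (`|a|%:C)%C.
Proof. by rewrite normc_def /= expr0n addr0 sqrtr_sqr. Qed.

Lemma Re_continuous : continuous (fun x : Cplx R => complex.Re x : R).
Proof.
move=> x; apply/(@cvgrPdist_lt _ _ _ (nbhs x)) => e; rewrite -ltcR => e0.
have := @near_dist_lt _ (Cplx R) x _ e0.
apply: filterS => y; rewrite -ltcR; apply: le_lt_trans.
by have := normc_ge_Re (x - y); case: (x) (y) => [? ?] [? ?].
Qed.

Lemma Im_continuous : continuous (fun x : Cplx R => complex.Im x : R).
Proof.
move=> x; apply/(@cvgrPdist_lt _ _ _ (nbhs x)) => e; rewrite -ltcR => e0.
have := @near_dist_lt _ (Cplx R) x _ e0.
apply: filterS => y; rewrite -ltcR; apply: le_lt_trans.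
by have := normc_ge_Im (x - y); case: (x) (y) => [? ?] [? ?].
Qed.

Lemma complexr_continuous : continuous (fun a => (a%:C)%C : Cplx R).
Proof.
move=> a; apply/(@cvgrPdist_lt _ _ _ (nbhs a)) => e e0.
have er : e = ((complex.Re e)%:C)%C by rewrite RRe_real// gtr0_real.
have re0 : 0 < complex.Re e by rewrite -ltcR -er.
have := @near_dist_lt R R a _ re0; apply: filterS => b.
by rewrite -rmorphB norm_complexr er ltcR.
Qed.

Lemma cvg_complex (T : Type) (F : set_system T) (FF : Filter F) (f g : T -> R) a b :
  f @ F --> a -> g @ F --> b ->
  (fun t => (f t +i* g t)%C : Cplx R) @ F --> ((a +i* b)%C : Cplx R).
Proof.
move=> fa gb.
have cE c d : ((c +i* d)%C : Cplx R) = (c%:C)%C + 'i * (d%:C)%C.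
  by rewrite -complexiE; apply: complex_eq => /=; ring.
under eq_fun do rewrite cE.
rewrite cE; apply: cvgD.
  by apply: (cvg_comp _ _ fa); apply: complexr_continuous.
apply: cvgM; first exact: cvg_cst.
by apply: (cvg_comp _ _ gb); apply: complexr_continuous.
Qed.

Lemma cexpD x y : cexp (x + y) = cexp x * cexp y.
Proof.
case: x y => [a b] [c d]; apply: complex_eq => /=;
  rewrite expRD ?cosD ?sinD; ring.
Qed.

Lemma cexp0 : cexp (0 : Cplx R) = 1.
Proof. by apply: complex_eq; rewrite /= expR0 ?cos0 ?sin0 !mul1r. Qed.

Lemma cexp_neq0 x : cexp x != 0.
Proof.
apply: contra_eq_neq (cexp0) => x0; rewrite -(subrr x) cexpD x0 mul0r.
by rewrite eq_sym oner_neq0.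
Qed.

(** The addition law reduces differentiability at [x] to differentiability at 0, which comes from
    the real derivatives of [expR], [cos] and [sin] at 0. *)
Lemma is_derive_cexp x : is_derive x 1 (@cexp R) (cexp x).
Proof.
have /caratheodoryP[E [eE Ec E0]] := is_derive_expR (0 : R).
have /caratheodoryP[C [cE Cc C0]] := is_derive_cos (0 : R).
have /caratheodoryP[S [sE Sc S0]] := is_derive_sin (0 : R).
rewrite expR0 in E0; rewrite sin0 oppr0 in C0; rewrite cos0 in S0.
suff [g [gE gc g0]] : exists g : Cplx R -> Cplx R,
    [/\ forall z, cexp z - 1 = g z * z, {for 0, continuous g} & g 0 = 1].
  apply/caratheodoryP; exists (fun z => cexp x * g (z - x)); split => [z||].
  - by rewrite -mulrA -gE mulrBr mulr1 -cexpD [x + _]addrC subrK.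
  - apply: continuousM; first exact: cst_continuous.
    apply: (@continuous_comp _ _ _ (fun z => z - x) g).
      by apply: continuousB; [exact: cvg_id | exact: cst_continuous].
    by rewrite /= subrr.
  - by rewrite subrr g0 mulr1.
(* [E], [C], [S] are the real slope functions at 0. Writing z = a + ib, the increment splits as (e^a
   - 1) + e^a (e^(ib) - 1), which gives the coefficients [P] of a and [Q] of b; they tend to 1 and
   to ['i]. *)
pose P z : Cplx R := ((E (complex.Re z))%:C)%C.
pose Q z : Cplx R := (expR (complex.Re z) * C (complex.Im z) +i*
                      (expR (complex.Re z) * S (complex.Im z)))%C.
have zE z : cexp z - 1 = P z * ((complex.Re z)%:C)%C + Q z * ((complex.Im z)%:C)%C.
  case: z => a b; rewrite /P /Q.
  have := eE a; have := cE b; have := sE b.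
  rewrite expR0 cos0 sin0 !subr0 => hs hc he.
  apply: complex_eq => /=; rewrite ?hs.
    rewrite mulr0 subr0 mulr0 subr0 -mulrA -hc -he; ring.
  by ring.
exists (fun z => if z == 0 then 1 else (cexp z - 1) / z); rewrite eqxx; split=> // [z|].
  by case: eqVneq => [->|z0]; rewrite ?cexp0 ?subrr ?mulr0// divfK.
have Re0 : (fun z : Cplx R => complex.Re z : R) @ (0 : Cplx R) --> (0 : R).
  exact: (@Re_continuous 0).
have Im0 : (fun z : Cplx R => complex.Im z : R) @ (0 : Cplx R) --> (0 : R).
  exact: (@Im_continuous 0).
have Pc : P @ (0 : Cplx R) --> (1 : Cplx R).
  have : (E (complex.Re z) : R) @[z --> (0 : Cplx R)] --> E 0 by exact: cvg_comp Re0 Ec.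
  by rewrite E0 => Pc; apply: (cvg_comp _ _ Pc); apply: complexr_continuous.
have eR : (expR (complex.Re z) : R) @[z --> (0 : Cplx R)] --> (1 : R).
  by have := cvg_comp _ _ Re0 (@continuous_expR R 0); rewrite expR0.
have Cc' : (C (complex.Im z) : R) @[z --> (0 : Cplx R)] --> (0 : R).
  by have : (C (complex.Im z) : R) @[z --> (0 : Cplx R)] --> C 0;
    [exact: cvg_comp Im0 Cc | rewrite C0].
have Sc' : (S (complex.Im z) : R) @[z --> (0 : Cplx R)] --> (1 : R).
  by have : (S (complex.Im z) : R) @[z --> (0 : Cplx R)] --> S 0;
    [exact: cvg_comp Im0 Sc | rewrite S0].
have Qc : Q @ (0 : Cplx R) --> ('i : Cplx R).
  have -> : 'i = (1 * 0 +i* (1 * 1))%C :> Cplx R by rewrite mulr0 mulr1 -complexiE.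
  exact: cvg_complex (cvgM eR Cc') (cvgM eR Sc').
apply/(@cvgrPdist_lt _ _ _ (nbhs (0 : Cplx R))) => e e0.
have e2 : 0 < e / 2 by rewrite divr_gt0.
have /(@cvgrPdist_lt _ _ _ (nbhs (0 : Cplx R)))/(_ _ e2) := Qc.
have /(@cvgrPdist_lt _ _ _ (nbhs (0 : Cplx R)))/(_ _ e2) := Pc.
apply: filterS2 => z Pz Qz; rewrite eqxx.
case: eqVneq => [_|z0]; first by rewrite subrr normr0.
have zRI : z = ((complex.Re z)%:C)%C + 'i * ((complex.Im z)%:C)%C.
  by rewrite -complexiE; case: (z) => a b; apply: complex_eq => /=; ring.
(* The weights Re z / z and Im z / z have modulus at most 1, so the error is at most the sum of the
   errors of [P] and [Q]. *)
have -> : 1 - (cexp z - 1) / z = (1 - P z) * (((complex.Re z)%:C)%C / z) +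
    ('i - Q z) * (((complex.Im z)%:C)%C / z).
  rewrite -[X in X - _](divff z0) {1}zRI zE; ring.
rewrite [e](splitr e); apply: le_lt_trans (ler_normD _ _) _.
apply: ltrD; rewrite normrM.
  apply: le_lt_trans Pz; rewrite ler_piMr// normrM normfV ler_pdivrMr ?normr_gt0//.
  by rewrite mul1r norm_complexr normc_ge_Re.
apply: le_lt_trans Qz; rewrite ler_piMr// normrM normfV ler_pdivrMr ?normr_gt0//.
by rewrite mul1r norm_complexr normc_ge_Im.
Qed.

(* On the right half-plane [u / cos (atan (v / u))] is the modulus of [u + iv]. *)
Lemma log_right_half_plane : exists l : Cplx R -> Cplx R,
  forall x, 0 < complex.Re x -> is_derive x 1 l x^-1 /\ cexp (l x) = x.
Proof.
pose th x : R := atan (complex.Im x / complex.Re x).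
pose l x : Cplx R := (ln (complex.Re x / cos (th x)) +i* th x)%C.
have cth x : 0 < cos (th x) by rewrite cos_atan invr_gt0 sqrtr_gt0 ltr_wpDr ?sqr_ge0.
have lK x : 0 < complex.Re x -> cexp (l x) = x.
  move=> x0; have m0 : 0 < complex.Re x / cos (th x) by rewrite divr_gt0.
  apply: complex_eq; rewrite /= lnK ?posrE// mulrAC -mulrA.
    by rewrite mulfV ?mulr1 ?gt_eqF.
  by rewrite -/(tan _) atanK mulrC divfK// gt_eqF.
exists l => x x0; split; last exact: lK.
have Rx := @Re_continuous x; have Ix := @Im_continuous x.
have thc : th @ x --> th x.
  apply: (@cvg_comp _ _ _ (fun x => complex.Im x / complex.Re x) (@atan R) _ _ _ _
    (@continuous_atan R _)).
  exact: cvgM Ix (cvgV (lt0r_neq0 x0) Rx).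
have mc : (fun y : Cplx R => complex.Re y / cos (th y) : R) @ x -->
    complex.Re x / cos (th x).
  have cthc : (fun y => cos (th y)) @ x --> cos (th x).
    exact: cvg_comp _ _ thc (@continuous_cos R _).
  have Vc := cvgV (lt0r_neq0 (cth x)) cthc.
  exact: cvgM Rx (Vc _).
have lc : {for x, continuous l}.
  have m0 : 0 < complex.Re x / cos (th x) by rewrite divr_gt0.
  exact: cvg_complex (cvg_comp _ _ mc (continuous_ln m0)) thc.
have xN : \forall y \near x, cexp (l y) = y.
  have xp : \forall y \near x, 0 < complex.Re y by exact: (cvgr_gt _ Rx _ x0).
  by near=> y; apply: lK; near: y.
rewrite -[X in X^-1](lK x x0).
by apply: is_derive_right_inverse xN (is_derive_cexp _) (cexp_neq0 _).
Unshelve. all: by end_near. Qed.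

(** Polar coordinates: the real part is the logarithm of the modulus, and the argument is plus or
    minus [acos (a / m)], with the sign of b. *)
Lemma cexp_surj x : x != 0 -> exists y, cexp y = x.
Proof.
case: x => a b ab0.
have m0 : 0 < a ^+ 2 + b ^+ 2.
  rewrite lt_neqAle addr_ge0 ?sqr_ge0// andbT eq_sym paddr_eq0 ?sqr_ge0//.
  by rewrite !sqrf_eq0; apply: contra ab0; rewrite eq_complex.
pose m := Num.sqrt (a ^+ 2 + b ^+ 2).
have mp : 0 < m by rewrite sqrtr_gt0.
have mN : m != 0 by rewrite gt_eqF.
have mE : m ^+ 2 = a ^+ 2 + b ^+ 2 by rewrite sqr_sqrtr// ltW.
have am : (a / m) ^+ 2 + (b / m) ^+ 2 = 1.
  by rewrite !expr_div_n -mulrDl -mE divff// sqrf_eq0.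
have a1 : -1 <= a / m <= 1.
  by rewrite -ler_norml -sqrtr_sqr -sqrtr1 ler_wsqrtr// -am lerDl sqr_ge0.
have [t ct st] : exists2 t, cos t = a / m & sin t = b / m.
  have sE : sin (acos (a / m)) = `|b / m|.
    by rewrite sin_acos// -am addrC addKr sqrtr_sqr.
  have [b0|b0] := leP 0 (b / m).
    by exists (acos (a / m)); rewrite ?acosK// sE ger0_norm.
  exists (- acos (a / m)); first by rewrite cosN acosK.
  by rewrite sinN sE ltr0_norm// opprK.
exists (ln m +i* t)%C; apply: complex_eq; rewrite /= lnK ?posrE// ?ct ?st.
  by rewrite mulrC divfK.
by rewrite mulrC divfK.
Qed.

(** For x near z the quotient x / z is near 1, hence in the right half-plane, where a logarithm is
    already available; adding a fixed logarithm [w] of z moves it back to x. *)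
Lemma log_branch_exists z : z != 0 -> exists l, log_branch l z.
Proof.
move=> z0; have [w wE] := cexp_surj z0.
have [L LP] := log_right_half_plane.
have zc : (fun x : Cplx R => x / z) @ z --> z / z.
  exact: cvgM (@cvg_id _ (nbhs z)) (cvg_cst z^-1).
rewrite (divff z0) in zc.
have Rc : (fun x : Cplx R => complex.Re (x / z) : R) @ z --> (1 : R).
  exact: cvg_comp _ _ zc (@Re_continuous 1).
exists (fun x => L (x / z) + w).
have zp : \forall x \near z, 0 < complex.Re (x / z).
  by exact: (cvgr_gt _ Rc _ (@ltr01 R)).
move: zp; apply: filterS => x x0.
have [dL eL] := LP _ x0; split; last by rewrite cexpD eL wE divfK.
apply: derivableD; last exact: derivable_cst.
suff [] : is_derive x 1 (L \o (fun x => x * z^-1)) ((x / z)^-1 * z^-1) by [].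
exact: (is_derive1_comp_num (g := fun y => y * z^-1) dL (is_derive_mulr _ _)).
Qed.

Lemma is_derive_log_branch l z : log_branch l z -> is_derive z 1 l z^-1.
Proof.
move=> lz; have [dl el] := nbhs_singleton lz.
rewrite -[X in X^-1]el; apply: is_derive_right_inverse (is_derive_cexp _) (cexp_neq0 _).
  exact/differentiable_continuous/derivable1_diffP.
by move: lz; apply: filterS => x [].
Qed.

Lemma is_derive_sqrt_branch s z : z != 0 -> sqrt_branch s z ->
  is_derive z 1 s (2 * s z)^-1.
Proof.
move=> z0 sz; have [ds es] := nbhs_singleton sz.
have s0 : s z != 0 by apply: contra_neq z0 => s0; rewrite -es s0 expr0n.
apply: (@is_derive_right_inverse _ (fun x => x * x)).
- exact/differentiable_continuous/derivable1_diffP.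
- by move: sz; apply: filterS => x [_]; rewrite expr2.
- apply: is_derive_eq (is_deriveM (is_derive_id _ _) (is_derive_id _ _)) _.
  by rewrite /GRing.scale /= mulr1 mulr_natl.
- by rewrite mulf_neq0// pnatr_eq0.
Qed.

(** With a logarithm [l] near z, the function exp (l x / 2) is a square root of x; dividing by its
    value at z and multiplying by [k] gives the prescribed value there, and the constant factor
    squares to 1. *)
Lemma sqrt_branch_exists z k : k != 0 -> k ^+ 2 = z ->
  exists2 s, sqrt_branch s z & s z = k.
Proof.
move=> k0 kz; have z0 : z != 0 by rewrite -kz expf_neq0.
have [l lz] := log_branch_exists z0; have [_ el] := nbhs_singleton lz.
have eK x : cexp (x / 2) ^+ 2 = cexp x by rewrite expr2 -cexpD -splitr.
exists (fun x => k / cexp (l z / 2) * cexp (l x / 2)); last first.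
  by rewrite divfK// cexp_neq0.
move: lz; apply: filterS => x [dx ex]; split; last first.
  by rewrite exprMn expr_div_n !eK kz el ex divff// mul1r.
apply: derivableM; first exact: derivable_cst.
suff [] : is_derive x 1 (@cexp R \o ((fun y => y * 2^-1) \o l))
    (cexp (l x / 2) * (2^-1 * 'D_1 l x)) by [].
apply: is_derive1_comp_num; first exact: is_derive_cexp.
by apply: is_derive1_comp_num; [exact: is_derive_mulr | exact: derivableP].
Qed.

End ComplexLog.

(** * Partial derivatives of the generating function *)

(** Covers both kinds of z-derivative: [t] is the varied coordinate z_i^- or z~_i^+, [e] is eta -
    lambda_i times the other one, [u] is the y-variable divided by [t], and [r] is the rest of the
    bracket. The logarithm contributes 2 k' / (1 - k^2) with k' = e / (2k) and 1 - k^2 = - e t,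
    hence the simple last term. *)
Lemma is_derive_site (K : numFieldType) (s l : K -> K) (c e u r m k t : K) :
  e != 0 -> t != 0 -> k != 0 -> k = s (1 + e * t) -> k ^+ 2 = 1 + e * t ->
  is_derive (1 + e * t) 1 s (2 * k)^-1 ->
  is_derive ((1 + k) / (1 - k)) 1 l ((1 + k) / (1 - k))^-1 ->
  is_derive t 1 (fun y => - c * (s (1 + e * y) * (u / y + r)) +
    c * (m * l ((1 + s (1 + e * y)) / (1 - s (1 + e * y)))))
  (- c * (e / (2 * k) * (u / t + r) - k * u / t ^+ 2) - c * m / (k * t)).
Proof.
move=> e0 t0 k0 kE kk ds dl.
have k1 : (1 - k) * (1 + k) != 0.
  have -> : (1 - k) * (1 + k) = - (e * t).
    by transitivity (1 - k ^+ 2); [ring | rewrite kk; ring].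
  by rewrite oppr_eq0 mulf_neq0.
have [k1m k1p] : 1 - k != 0 /\ 1 + k != 0.
  by move: k1; rewrite mulf_eq0 negb_or => /andP.
pose S (y : K) := s (1 + e * y).
have dA : is_derive t 1 (fun y => 1 + e * y) e.
  by under eq_fun do rewrite mulrC; apply: is_derive_affine.
have dS : is_derive t 1 S ((2 * k)^-1 * e).
  exact: (is_derive1_comp_num (g := fun y => 1 + e * y) ds dA).
have dP : is_derive t 1 (fun y => 1 + S y) ((2 * k)^-1 * e).
  rewrite -[X in is_derive _ _ _ X]add0r.
  exact: is_deriveD (is_derive_cst (1 : K) t 1) dS.
have dM : is_derive t 1 (fun y => 1 - S y) (- ((2 * k)^-1 * e)).
  rewrite -[X in is_derive _ _ _ X]add0r.
  exact: is_deriveB (is_derive_cst (1 : K) t 1) dS.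
have dV : is_derive t 1 (fun y => (1 - S y)^-1) ((2 * k)^-1 * e / (1 - k) ^+ 2).
  have k1S : 1 - S t != 0 by rewrite /S -kE.
  by have := is_deriveV_num (f := fun y => 1 - S y) k1S dM; rewrite opprK /S -kE.
have dU : is_derive t 1 (fun y : K => u / y + r) (0 * t^-1 + u * (- 1 / t ^+ 2) + 0).
  exact: is_deriveD (is_deriveM_num (is_derive_cst u t 1)
    (is_deriveV_num (f := id) t0 (is_derive_id t 1))) (is_derive_cst r t 1).
have dlS : is_derive ((1 + S t) / (1 - S t)) 1 l ((1 + k) / (1 - k))^-1.
  by rewrite /S -kE.
have dL := is_derive1_comp_num (g := fun y => (1 + S y) / (1 - S y)) dlS
  (is_deriveM_num dP dV).
have dT := is_deriveD
  (is_deriveM_num (is_derive_cst (- c : K) t 1) (is_deriveM_num dS dU))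
  (is_deriveM_num (is_derive_cst (c : K) t 1)
    (is_deriveM_num (is_derive_cst m t 1) dL)).
apply: is_derive_eq dT _.
have St : S t = k by rewrite /S -kE.
rewrite /= !St !mul0r !add0r addr0.
(* Eliminating [e] builds the relation between k and t into the goal, which becomes an identity of
   rational functions. *)
have -> : e = (k ^+ 2 - 1) / t by rewrite kk; field.
field.
by rewrite k0 t0 k1m k1p.
Qed.

Section GeneratingFunction.
Variable R : realType.
Local Notation C := (Cplx R).

(** Isolates the only term of a sum over sites that depends on the varied coordinate. *)
Lemma sum_update (V : nmodType) (T : Type) (N : nat) (G : 'I_N -> T -> V)
    (x : 'I_N -> T) (i : 'I_N) (t : T) :
  \sum_(j < N) G j ([eta x with i |-> t] j) =
  \sum_(j < N | j != i) G j (x j) + G i t.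
Proof.
rewrite (bigD1 i)//= eqxx addrC; congr (_ + _).
by apply: eq_bigr => j /negPf ->.
Qed.

Lemma partial_val (N : nat) (f : ('I_N -> C) -> C) (x : 'I_N -> C) i (a : C) :
  is_derive (x i) 1 (fun t => f [eta x with i |-> t]) a -> partial f x i = a.
Proof. by move=> df; rewrite /partial derive1E derive_val. Qed.

Variables (N : nat) (w eta : C) (lambda ell : 'I_N -> C) (s l : 'I_N -> C -> C).
Variables zm ym zp yp : 'I_N -> C.
Let k i := s i (k_arg lambda eta zm zp i).

Lemma partial_gen_fun_ym i :
  partial (fun y => gen_fun w lambda eta ell s l zm y zp yp) ym i =
  - ('i / (2 * w)) * (\sum_(j < N) yp j) - 'i * (k i / zm i).
Proof.
apply: partial_val.
pose H y j := k j * (y / zm j + yp j / zp j - (eta - lambda j)^-1).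
(* The generating function is affine in y_i^-; [b] is its constant term. *)
pose b := - ('i / (2 * w)) * (\sum_(j < N | j != i) \sum_(n < N) ym j * yp n)
  - 'i * (\sum_(j < N | j != i) H (ym j) j + k i * (yp i / zp i - (eta - lambda i)^-1))
  + 'i * (\sum_(j < N) ell j * l j ((1 + k j) / (1 - k j))) - 'i * w * N%:R * eta.
rewrite (_ : (fun t => _) = fun t => b + t *
  (- ('i / (2 * w)) * (\sum_(j < N) yp j) - 'i * (k i / zm i))).
  exact: is_derive_affine.
apply/funext => t; rewrite /gen_fun.
rewrite (sum_update (fun j y => \sum_(n < N) y * yp n)).
rewrite (sum_update (fun j y => H y j)) -mulr_sumr /b /H /k.
ring.
Qed.

Lemma partial_gen_fun_yp i :
  partial (fun y => gen_fun w lambda eta ell s l zm ym zp y) yp i =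
  - ('i / (2 * w)) * (\sum_(j < N) ym j) - 'i * (k i / zp i).
Proof.
apply: partial_val.
pose H y j := k j * (ym j / zm j + y / zp j - (eta - lambda j)^-1).
pose b := - ('i / (2 * w)) * (\sum_(j < N | j != i) \sum_(n < N) ym n * yp j)
  - 'i * (\sum_(j < N | j != i) H (yp j) j + k i * (ym i / zm i - (eta - lambda i)^-1))
  + 'i * (\sum_(j < N) ell j * l j ((1 + k j) / (1 - k j))) - 'i * w * N%:R * eta.
rewrite (_ : (fun t => _) = fun t => b + t *
  (- ('i / (2 * w)) * (\sum_(j < N) ym j) - 'i * (k i / zp i))).
  exact: is_derive_affine.
(* The varied variable carries the inner index of the double sum, so the sums are exchanged
   first. *)
apply/funext => t; rewrite /gen_fun exchange_big.
rewrite (sum_update (fun j y => \sum_(n < N) ym n * y)).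
rewrite (sum_update (fun j y => H y j)) -mulr_suml /b /H /k.
ring.
Qed.

Hypotheses (zm0 : forall i, zm i != 0) (zp0 : forall i, zp i != 0).
Hypothesis eta0 : forall i, eta != lambda i.
Hypothesis a0 : forall i, k_arg lambda eta zm zp i != 0.
Hypothesis sP : forall i, sqrt_branch (s i) (k_arg lambda eta zm zp i).
Hypothesis lP : forall i, log_branch (l i) ((1 + k i) / (1 - k i)).

Lemma sqr_k i : k i ^+ 2 = 1 + (eta - lambda i) * zm i * zp i.
Proof. by have [_] := nbhs_singleton (sP i). Qed.

Lemma k_neq0 i : k i != 0.
Proof. by rewrite -sqrf_eq0 sqr_k; exact: a0. Qed.

Lemma partial_gen_fun_zm i :
  partial (fun z => gen_fun w lambda eta ell s l z ym zp yp) zm i =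
  - 'i * ((eta - lambda i) * zp i / (2 * k i) *
      (ym i / zm i + (yp i / zp i - (eta - lambda i)^-1)) - k i * ym i / zm i ^+ 2)
    - 'i * ell i / (k i * zm i).
Proof.
apply: partial_val.
have kE : k i = s i (1 + (eta - lambda i) * zp i * zm i) by rewrite /k /k_arg mulrAC.
have aE : k_arg lambda eta zm zp i = 1 + (eta - lambda i) * zp i * zm i.
  by rewrite /k_arg mulrAC.
have e0 : (eta - lambda i) * zp i != 0 by rewrite mulf_neq0 ?subr_eq0.
have kk : k i ^+ 2 = 1 + (eta - lambda i) * zp i * zm i by rewrite sqr_k mulrAC.
have ds := is_derive_sqrt_branch (a0 i) (sP i); rewrite -/(k i) aE in ds.
have dF := is_derive_site 'i (ym i) (yp i / zp i - (eta - lambda i)^-1) (ell i)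
  e0 (zm0 i) (k_neq0 i) kE kk ds (is_derive_log_branch (lP i)).
pose K z j := s j (1 + (eta - lambda j) * z * zp j).
pose H z j := K z j * (ym j / z + yp j / zp j - (eta - lambda j)^-1).
pose G z j := ell j * l j ((1 + K z j) / (1 - K z j)).
(* [b] collects everything independent of z_i^-; what remains is the function of one site
   differentiated above. *)
pose b := - ('i / (2 * w)) * (\sum_(j < N) \sum_(n < N) ym j * yp n)
  - 'i * (\sum_(j < N | j != i) H (zm j) j)
  + 'i * (\sum_(j < N | j != i) G (zm j) j) - 'i * w * N%:R * eta.
have := is_deriveD (is_derive_cst b (zm i) 1) dF; rewrite add0r.
congr (is_derive _ _ _ _); apply/funext => t; rewrite /gen_fun.
rewrite (sum_update (fun j z => H z j)) (sum_update (fun j z => G z j)).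
rewrite fctE /= /b /H /G /K ![_ * t * _]mulrAC.
ring.
Qed.

Lemma partial_gen_fun_zp i :
  partial (fun z => gen_fun w lambda eta ell s l zm ym z yp) zp i =
  - 'i * ((eta - lambda i) * zm i / (2 * k i) *
      (yp i / zp i + (ym i / zm i - (eta - lambda i)^-1)) - k i * yp i / zp i ^+ 2)
    - 'i * ell i / (k i * zp i).
Proof.
apply: partial_val.
have e0 : (eta - lambda i) * zm i != 0 by rewrite mulf_neq0 ?subr_eq0.
have dF := is_derive_site 'i (yp i) (ym i / zm i - (eta - lambda i)^-1) (ell i)
  e0 (zp0 i) (k_neq0 i) erefl (sqr_k i) (is_derive_sqrt_branch (a0 i) (sP i))
  (is_derive_log_branch (lP i)).
pose K z j := s j (1 + (eta - lambda j) * zm j * z).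
pose H z j := K z j * (ym j / zm j + yp j / z - (eta - lambda j)^-1).
pose G z j := ell j * l j ((1 + K z j) / (1 - K z j)).
pose b := - ('i / (2 * w)) * (\sum_(j < N) \sum_(n < N) ym j * yp n)
  - 'i * (\sum_(j < N | j != i) H (zp j) j)
  + 'i * (\sum_(j < N | j != i) G (zp j) j) - 'i * w * N%:R * eta.
have := is_deriveD (is_derive_cst b (zp i) 1) dF; rewrite add0r.
congr (is_derive _ _ _ _); apply/funext => t; rewrite /gen_fun.
rewrite (sum_update (fun j z => H z j)) (sum_update (fun j z => G z j)).
rewrite fctE /= /b /H /G /K.
ring.
Qed.

End GeneratingFunction.

(** * Uniqueness of partial fractions with poles of order at most two *)

Section PartialFractions.
Variable K : numFieldType.

(** A numeric field has characteristic 0, so the integers below [size P] are already too many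
    distinct roots. *)
Lemma poly_eq0_horner (P : {poly K}) : (forall x, P.[x] = 0) -> P = 0.
Proof.
move=> P0; apply/eqP; apply: contraTT isT => Pn0.
have := max_poly_roots (rs := [seq (i%:R : K) | i <- iota 0 (size P)]) Pn0.
rewrite size_map size_iota ltnn; apply.
  by apply/allP => _ /mapP[i _ ->]; rewrite rootE P0.
by rewrite map_inj_uniq ?iota_uniq// => i j /eqP; rewrite eqr_nat => /eqP.
Qed.

Variables (N : nat) (lambda : 'I_N -> K).
Hypothesis lambda_inj : injective lambda.

(** Clearing denominators gives a polynomial [P] that must vanish. Its value at lambda_i is a_i
    times a nonzero product of differences; once all a_i vanish, only [c *: D] is left. *)
Lemma simple_poles_eq0 (c : K) (a : 'I_N -> K) :
  (forall x, (forall i, x != lambda i) ->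
    c + \sum_(i < N) (x - lambda i)^-1 * a i = 0) ->
  c = 0 /\ forall i, a i = 0.
Proof.
move=> h.
pose D := \prod_(i < N) ('X - (lambda i)%:P).
pose E i := \prod_(j < N | j != i) ('X - (lambda j)%:P).
have DE i : D = ('X - (lambda i)%:P) * E i by rewrite /D (bigD1 i).
have DN0 : D != 0 by apply/prodf_neq0 => i _; rewrite polyXsubC_eq0.
pose P := c *: D + \sum_(i < N) a i *: E i.
have P0 : P = 0.
  (* The hypothesis says nothing at the poles; the extra factor [D] vanishes there, so the product
     is zero at every point. *)
  suff : D * P = 0 by move/eqP; rewrite mulf_eq0 (negPf DN0) => /eqP.
  apply: poly_eq0_horner => x; rewrite hornerM.
  have [[i xi]|nx] := pselect (exists i, x = lambda i).
    by rewrite (DE i) hornerM hornerXsubC xi subrr !mul0r.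
  have xN i : x != lambda i by apply/eqP => xi; apply: nx; exists i.
  rewrite [P.[x]](_ : _ = D.[x] * (c + \sum_(i < N) (x - lambda i)^-1 * a i)).
    by rewrite h// !mulr0.
  rewrite /P hornerD hornerZ horner_sum mulrDr [c * _]mulrC mulr_sumr.
  congr (_ + _); apply: eq_bigr => i _; rewrite hornerZ (DE i) hornerM.
  by rewrite hornerXsubC; field; rewrite subr_eq0.
have Ei i j : i != j -> (E i).[lambda j] = 0.
  by move=> ij; rewrite /E (bigD1 j) 1?eq_sym// hornerM hornerXsubC subrr mul0r.
have Eii i : (E i).[lambda i] != 0.
  rewrite horner_prod; apply/prodf_neq0 => j ji.
  by rewrite !hornerE subr_eq0 (inj_eq lambda_inj) eq_sym.
have a0 i : a i = 0.
  have := congr1 (horner^~ (lambda i)) P0; rewrite /= horner0 hornerD hornerZ.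
  rewrite (DE i) hornerM hornerXsubC subrr mul0r mulr0 add0r horner_sum (bigD1 i)//=.
  rewrite big1 ?addr0 => [|j ji]; last by rewrite hornerZ Ei// mulr0.
  by rewrite hornerZ => /eqP; rewrite mulf_eq0 (negPf (Eii i)) orbF => /eqP.
split=> //; move/eqP: P0; rewrite /P big1 ?addr0 => [|i _]; last by rewrite a0 scale0r.
by rewrite scaler_eq0 (negPf DN0) orbF => /eqP.
Qed.

Lemma double_poles_eq0 (c : K) (a b : 'I_N -> K) :
  (forall x, (forall i, x != lambda i) ->
    c + \sum_(i < N) ((x - lambda i)^-1 * a i + ((x - lambda i) ^+ 2)^-1 * b i) = 0) ->
  [/\ c = 0, forall i, a i = 0 & forall i, b i = 0].
Proof.
move=> h.
suff b0 i : b i = 0.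
  have [|c0 a0] := @simple_poles_eq0 c a; last by split.
  move=> x xl; rewrite -[RHS](h x xl); congr (_ + _); apply: eq_bigr => i _.
  by rewrite b0 mulr0 addr0.
pose D2 := \prod_(i < N) ('X - (lambda i)%:P) ^+ 2.
pose E i := \prod_(j < N | j != i) ('X - (lambda j)%:P) ^+ 2.
have DE j : D2 = ('X - (lambda j)%:P) ^+ 2 * E j by rewrite /D2 (bigD1 j).
have DN0 : D2 != 0 by apply/prodf_neq0 => j _; rewrite expf_eq0 polyXsubC_eq0.
pose P := c *: D2 + \sum_(i < N) (a i *: (('X - (lambda i)%:P) * E i) + b i *: E i).
have P0 : P = 0.
  suff : D2 * P = 0 by move/eqP; rewrite mulf_eq0 (negPf DN0) => /eqP.
  apply: poly_eq0_horner => x; rewrite hornerM.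
  have [[j xj]|nx] := pselect (exists i, x = lambda i).
    by rewrite (DE j) hornerM horner_exp hornerXsubC xj subrr expr0n !mul0r.
  have xN j : x != lambda j by apply/eqP => xj; apply: nx; exists j.
  rewrite [P.[x]](_ : _ = D2.[x] * (c + \sum_(i < N)
      ((x - lambda i)^-1 * a i + ((x - lambda i) ^+ 2)^-1 * b i))).
    by rewrite h// !mulr0.
  rewrite /P hornerD hornerZ horner_sum mulrDr [c * _]mulrC mulr_sumr.
  congr (_ + _); apply: eq_bigr => j _; rewrite hornerD !hornerZ (DE j) !hornerM.
  by rewrite !hornerXsubC; field; rewrite subr_eq0.
have Ei j : j != i -> (E j).[lambda i] = 0.
  by move=> ij; rewrite /E (bigD1 i) 1?eq_sym// hornerM horner_exp
    hornerXsubC subrr expr0n mul0r.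
have Eii : (E i).[lambda i] != 0.
  rewrite horner_prod; apply/prodf_neq0 => j ji.
  by rewrite !hornerE expf_eq0/= subr_eq0 (inj_eq lambda_inj) eq_sym.
(* At lambda_i every term but b_i E_i vanishes, so the double-pole coefficients go first and simple
   poles remain. *)
have := congr1 (horner^~ (lambda i)) P0; rewrite /= horner0 hornerD hornerZ.
rewrite (DE i) hornerM horner_exp hornerXsubC subrr expr0n mul0r mulr0 add0r
  horner_sum (bigD1 i)//=.
rewrite big1 ?addr0 => [|j ji]; last first.
  by rewrite hornerD !hornerZ hornerM Ei// !mulr0 addr0.
rewrite hornerD !hornerZ hornerM hornerXsubC subrr mul0r mulr0 add0r => /eqP.
by rewrite mulf_eq0 (negPf Eii) orbF => /eqP.
Qed.

End PartialFractions.

(** * Algebra of the intertwining relation at a single site *)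

Section SiteEquations.
Variable K : numFieldType.

Lemma eq_subr_eq (V : zmodType) (a b c d : V) : c = d -> a - b = c - d -> a = b.
Proof. by move=> ->; rewrite subrr => /eqP; rewrite subr_eq0 => /eqP. Qed.

(** Derives an equation from a known one by a polynomial identity, up to a nonzero factor; [c = d]
    will be a combination of hypotheses and the identity is left to [ring] or [field]. *)
Lemma eq_mulr_subr_eq (u a b c d : K) :
  u != 0 -> c = d -> u * (a - b) = c - d -> a = b.
Proof.
move=> u0 ->; rewrite subrr => /eqP.
by rewrite mulf_eq0 (negPf u0)/= subr_eq0 => /eqP.
Qed.

(* Principal parts at [lambda_i] of the entries of the intertwining relation,
   with [d = eta - lambda_i]; primed variables are the new ones. The upper left
   entry is omitted: it follows from the three others. *)
Definition site_eqs (p q d y3 ym yp z3 zm zp y3' ym' yp' z3' zm' zp' : K) :=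
  [/\ z3 - q * zm = z3' - p * zp',
      (p * q - d) * zm = p * (z3 + z3') + zm' &
      (p * q - d) * zp' = q * (z3 + z3') + zp] /\
  [/\ y3 - q * ym = y3' - p * yp',
      (p * q - d) * ym + zm = p * (y3 + y3') + ym' &
      (p * q - d) * yp' + zp' = q * (y3 + y3') + yp].

Variables p q d ell y3 ym yp z3 zm zp y3' ym' yp' z3' zm' zp' : K.
Hypothesis cas_yz : y3 * z3 + 2^-1 * (ym * zp + yp * zm) = ell.
Hypothesis cas_z : z3 ^+ 2 + zm * zp = 1.
Hypothesis cas_yz' : y3' * z3' + 2^-1 * (ym' * zp' + yp' * zm') = ell.
Hypothesis cas_z' : z3' ^+ 2 + zm' * zp' = 1.
Hypothesis zm_neq0 : zm != 0.
Hypothesis zp'_neq0 : zp' != 0.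

(** Forwards, k and c are the common values of the two diagonal equations, and eliminating z^+ and
    y^+ from the old Casimirs gives the quadratic relations. Backwards, each off-diagonal equation,
    multiplied by z~^+ or z^-, is the difference between a quadratic relation and a new or old
    Casimir, up to the equations already recovered. *)
Lemma site_eqsP :
  site_eqs p q d y3 ym yp z3 zm zp y3' ym' yp' z3' zm' zp' <->
  exists k c, [/\ k ^+ 2 = 1 + d * zm * zp', z3 = q * zm + k & z3' = p * zp' + k] /\
    [/\ 2 * (k * c) = 2 * ell + d * (ym * zp' + yp' * zm) - zm * zp',
        y3 = q * ym + c & y3' = p * yp' + c].
Proof.
split=> [[[zE _ zpE] [yE _ ypE]]|].
  exists (z3 - q * zm), (y3 - q * ym).
  have z3'E : z3' = z3 - q * zm + p * zp' by rewrite zE subrK.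
  have y3'E : y3' = y3 - q * ym + p * yp' by rewrite yE subrK.
  split; split; rewrite ?[_ + (_ - _)]addrC ?subrK// ?[_ + p * _]addrC//.
  - apply: eq_subr_eq cas_z _.
    have -> : zp = (p * q - d) * zp' - q * (z3 + z3') by rewrite zpE addrC addKr.
    rewrite z3'E; ring.
  - apply: eq_subr_eq (congr1 ( *%R 2) cas_yz) _.
    have -> : zp = (p * q - d) * zp' - q * (z3 + z3') by rewrite zpE addrC addKr.
    have -> : yp = (p * q - d) * yp' + zp' - q * (y3 + y3') by rewrite ypE addrC addKr.
    by rewrite z3'E y3'E; field.
move=> [k [c [[kk z3E z3'E] [kc y3E y3'E]]]].
have zmE : (p * q - d) * zm = p * (z3 + z3') + zm'.
  apply: eq_mulr_subr_eq zp'_neq0 (congr2 (fun a b => a - b) kk cas_z') _.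
  rewrite z3E z3'E; ring.
have zpE : (p * q - d) * zp' = q * (z3 + z3') + zp.
  apply: eq_mulr_subr_eq zm_neq0 (congr2 (fun a b => a - b) kk cas_z) _.
  rewrite z3E z3'E; ring.
have zE : z3 - q * zm = z3' - p * zp' by rewrite z3E z3'E; ring.
have yE : y3 - q * ym = y3' - p * yp' by rewrite y3E y3'E; ring.
split; split=> //.
- apply: eq_mulr_subr_eq zp'_neq0 (congr2 (fun a b => a - 2 * b) kc cas_yz') _.
  have -> : zm' = (p * q - d) * zm - p * (z3 + z3') by rewrite zmE addrC addKr.
  by rewrite z3E z3'E y3E y3'E; field.
- apply: eq_mulr_subr_eq zm_neq0 (congr2 (fun a b => a - 2 * b) kc cas_yz) _.
  have -> : zp = (p * q - d) * zp' - q * (z3 + z3') by rewrite zpE addrC addKr.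
  by rewrite z3E z3'E y3E y3'E; field.
Qed.
End SiteEquations.

(** * Principal parts of the intertwining relation *)

Section Polar.
Variables (K : numFieldType) (N : nat) (lambda : 'I_N -> K).

Definition polar (a b : 'I_N -> K) (x : K) : K :=
  \sum_(i < N) ((x - lambda i)^-1 * a i + ((x - lambda i) ^+ 2)^-1 * b i).

Lemma polar_comb (u u' u'' : K) (a b a1 b1 a2 b2 a3 b3 : 'I_N -> K) x :
  polar a b x + u * polar a1 b1 x + u' * polar a2 b2 x + u'' * polar a3 b3 x =
  polar (fun i => a i + u * a1 i + u' * a2 i + u'' * a3 i)
        (fun i => b i + u * b1 i + u' * b2 i + u'' * b3 i) x.
Proof.
rewrite /polar !mulr_sumr -!big_split; apply: eq_bigr => i _ /=; ring.
Qed.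

(** Write x - c = (x - lambda_i) + (lambda_i - c) in each term: the first summand lowers the order
    of the pole by one. The constant it leaves is what determines p and q. *)
Lemma polar_shift (c : K) (a b : 'I_N -> K) x : (forall i, x != lambda i) ->
  (x - c) * polar a b x = \sum_(i < N) a i +
    polar (fun i => (lambda i - c) * a i + b i) (fun i => (lambda i - c) * b i) x.
Proof.
move=> xl; rewrite /polar mulr_sumr -big_split; apply: eq_bigr => i _ /=.
by field; rewrite subr_eq0.
Qed.

Lemma polar_eq0P (c : K) (a b : 'I_N -> K) : injective lambda ->
  (forall x, (forall i, x != lambda i) -> c + polar a b x = 0) <->
  [/\ c = 0, forall i, a i = 0 & forall i, b i = 0].
Proof.
move=> linj; split=> [|[-> a0 b0] x _]; first exact: double_poles_eq0.
by rewrite add0r /polar big1// => i _; rewrite a0 b0 !mulr0 addr0.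
Qed.

End Polar.

Section Intertwining.
Variable R : realType.
Local Notation C := (Cplx R).

Lemma mx2_inj (a b c d a' b' c' d' : C) :
  mx2 a b c d = mx2 a' b' c' d' -> [/\ a = a', b = b', c = c' & d = d'].
Proof.
move=> /matrixP e; have := e 0 0; have := e 0 1; have := e 1 0; have := e 1 1.
by rewrite !mxE /=.
Qed.

Lemma mulmx2 (a b c d a' b' c' d' : C) :
  mx2 a b c d *m mx2 a' b' c' d' =
  mx2 (a * a' + b * c') (a * b' + b * d') (c * a' + d * c') (c * b' + d * d').
Proof.
apply/matrixP => i j; rewrite !mxE !big_ord_recl big_ord0 !mxE addr0 /=.
by case: i j => [[|[|//]] ?] [[|[|//]] ?].
Qed.

Variables (N : nat) (w : C) (lambda : 'I_N -> C).

Lemma lax_mx2 (v : chain_vars R N) (x : C) :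
  let A := w + polar lambda (y3 v) (z3 v) x in
  lax w lambda v x = ('i / 2) *:
    mx2 A (polar lambda (ym v) (zm v) x) (polar lambda (yp v) (zp v) x) (- A).
Proof.
apply/matrixP => i j; rewrite !mxE summxE.
under eq_bigr do rewrite !mxE.
case: i j => [[|[|//]] ?] [[|[|//]] ?] /=.
- rewrite mulrDr mulr_sumr mulr1 mulrAC; congr (_ + _).
  by apply: eq_bigr => k _; ring.
- by rewrite mulr0 add0r mulr_sumr; apply: eq_bigr => k _; ring.
- by rewrite mulr0 add0r mulr_sumr; apply: eq_bigr => k _; ring.
- rewrite [RHS]mulrN mulrDr mulr_sumr opprD -sumrN mulrN1 mulrAC; congr (_ + _).
  by apply: eq_bigr => k _; ring.
Qed.

Variables (eta : C) (v v' : chain_vars R N).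

(** The three expressions are the lower right, upper right and lower left entries of the relation,
    up to sign and the common factor i/2. *)
Lemma intertwiningP (p q x : C) :
  let A u := w + polar lambda (y3 u) (z3 u) x in
  let B u := polar lambda (ym u) (zm u) x in
  let D u := polar lambda (yp u) (zp u) x in
  let m := x - (eta - p * q) in
  darboux eta p q x *m lax w lambda v x = lax w lambda v' x *m darboux eta p q x <->
  [/\ q * B v - A v - p * D v' + A v' = 0,
      m * B v - p * A v - p * A v' - B v' = 0 &
      m * D v' - q * A v' - q * A v - D v = 0].
Proof.
move=> A B D m; have mE : x - eta + p * q = m by rewrite /m; ring.
have i2 : 'i / 2 != 0 :> C by rewrite mulf_neq0 ?neq0Ci ?invr_eq0 ?pnatr_eq0.
rewrite !lax_mx2 /darboux mE -scalemxAr -scalemxAl !mulmx2 -/(A v) -/(A v') -/(B v)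
  -/(B v') -/(D v) -/(D v').
split=> [/(scalerI i2)/mx2_inj[_ e12 e21 e22]|[e22 e12 e21]].
  split.
  - by apply/eqP; rewrite -subr_eq0; move/eqP: e22; rewrite -subr_eq0;
      congr (_ == _); ring.
  - by apply/eqP; rewrite -subr_eq0; move/eqP: e12; rewrite -subr_eq0;
      congr (_ == _); ring.
  - by apply: eq_subr_eq (esym e21) _; ring.
congr (_ *: _).
(* Calling E22, E12, E21 the three vanishing expressions in order, the upper left entry is the
   combination q E12 - p E21 - m E22. *)
have e11 : m * A v + p * D v = A v' * m + B v' * q.
  apply: eq_subr_eq (congr2 (fun a b => a - b)
    (congr2 (fun a b => a - b) (congr1 ( *%R (- m)) e22) (congr1 ( *%R p) e21))
    (congr1 ( *%R (- q)) e12)) _.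
  ring.
have e12' : m * B v + p * - A v = A v' * p + B v' * 1
  by apply: eq_subr_eq e12 _; ring.
have e21' : q * A v + 1 * D v = D v' * m + - A v' * q.
  by apply/esym; apply: eq_subr_eq e21 _; ring.
have e22' : q * B v + 1 * - A v = D v' * p + - A v' * 1
  by apply: eq_subr_eq e22 _; ring.
by rewrite e11 e12' e21' e22'.
Qed.

Lemma backlundP : injective lambda ->
  backlund w lambda eta v v' <-> exists p q,
    [/\ \sum_(i < N) ym v i = 2 * w * p, \sum_(i < N) yp v' i = 2 * w * q &
        forall i, site_eqs p q (eta - lambda i)
          (y3 v i) (ym v i) (yp v i) (z3 v i) (zm v i) (zp v i)
          (y3 v' i) (ym v' i) (yp v' i) (z3 v' i) (zm v' i) (zp v' i)].
Proof.
move=> linj; rewrite /backlund.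
suff E p q : (forall x, (forall i, x != lambda i) ->
      darboux eta p q x *m lax w lambda v x =
      lax w lambda v' x *m darboux eta p q x) <->
    [/\ \sum_(i < N) ym v i = 2 * w * p, \sum_(i < N) yp v' i = 2 * w * q &
        forall i, site_eqs p q (eta - lambda i)
          (y3 v i) (ym v i) (yp v i) (z3 v i) (zm v i) (zp v i)
          (y3 v' i) (ym v' i) (yp v' i) (z3 v' i) (zm v' i) (zp v' i)].
  by split=> -[p [q /E h]]; exists p, q.
(* Chosen so that the upper left entry of the Darboux matrix is x - c and lambda_i - c = p q - (eta
   - lambda_i), the coefficient in the site equations. *)
pose c := eta - p * q.
have I22 := @polar_eq0P _ _ lambda 0
  (fun i => y3 v' i + q * ym v i + -1 * y3 v i + - p * yp v' i)
  (fun i => z3 v' i + q * zm v i + -1 * z3 v i + - p * zp v' i) linj.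
have I12 := @polar_eq0P _ _ lambda (\sum_(i < N) ym v i - 2 * w * p)
  (fun i => ((lambda i - c) * ym v i + zm v i) + - p * y3 v i + - p * y3 v' i
    + -1 * ym v' i)
  (fun i => ((lambda i - c) * zm v i) + - p * z3 v i + - p * z3 v' i
    + -1 * zm v' i) linj.
have I21 := @polar_eq0P _ _ lambda (\sum_(i < N) yp v' i - 2 * w * q)
  (fun i => ((lambda i - c) * yp v' i + zp v' i) + - q * y3 v' i + - q * y3 v i
    + -1 * yp v i)
  (fun i => ((lambda i - c) * zp v' i) + - q * z3 v' i + - q * z3 v i
    + -1 * zp v i) linj.
pose G (x : C) := intertwiningP p q x.
have P22 x : q * polar lambda (ym v) (zm v) x - (w + polar lambda (y3 v) (z3 v) x)
    - p * polar lambda (yp v') (zp v') x + (w + polar lambda (y3 v') (z3 v') x) =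
    0 + polar lambda (fun i => y3 v' i + q * ym v i + -1 * y3 v i + - p * yp v' i)
  (fun i => z3 v' i + q * zm v i + -1 * z3 v i + - p * zp v' i) x.
  by rewrite -polar_comb; ring.
have P12 x : (forall i, x != lambda i) ->
    (x - c) * polar lambda (ym v) (zm v) x - p * (w + polar lambda (y3 v) (z3 v) x)
    - p * (w + polar lambda (y3 v') (z3 v') x) - polar lambda (ym v') (zm v') x =
    \sum_(i < N) ym v i - 2 * w * p + polar lambda
  (fun i => ((lambda i - c) * ym v i + zm v i) + - p * y3 v i + - p * y3 v' i
    + -1 * ym v' i)
  (fun i => ((lambda i - c) * zm v i) + - p * z3 v i + - p * z3 v' i
    + -1 * zm v' i) x.
  by move=> xl; rewrite -polar_comb polar_shift//; ring.
have P21 x : (forall i, x != lambda i) ->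
    (x - c) * polar lambda (yp v') (zp v') x - q * (w + polar lambda (y3 v') (z3 v') x)
    - q * (w + polar lambda (y3 v) (z3 v) x) - polar lambda (yp v) (zp v) x =
    \sum_(i < N) yp v' i - 2 * w * q + polar lambda
  (fun i => ((lambda i - c) * yp v' i + zp v' i) + - q * y3 v' i + - q * y3 v i
    + -1 * yp v i)
  (fun i => ((lambda i - c) * zp v' i) + - q * z3 v' i + - q * z3 v i
    + -1 * zp v i) x.
  by move=> xl; rewrite -polar_comb polar_shift//; ring.
split=> [h|[sym syp sites]].
  have h3 x xl := (G x).1 (h x xl).
  have [|_ a22 b22] := I22.1; first by move=> x xl; rewrite -P22; case: (h3 x xl).
  have [|/eqP c12 a12 b12] := I12.1.
    by move=> x xl; rewrite -P12//; case: (h3 x xl).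
  have [|/eqP c21 a21 b21] := I21.1.
    by move=> x xl; rewrite -P21//; case: (h3 x xl).
  rewrite subr_eq0 in c12; rewrite subr_eq0 in c21.
  split=> [||i]; [exact/eqP | exact/eqP |].
  split; split.
  - by apply: eq_subr_eq (esym (b22 i)) _; ring.
  - by apply: eq_subr_eq (b12 i) _; rewrite /c; ring.
  - by apply: eq_subr_eq (b21 i) _; rewrite /c; ring.
  - by apply: eq_subr_eq (esym (a22 i)) _; ring.
  - by apply: eq_subr_eq (a12 i) _; rewrite /c; ring.
  - by apply: eq_subr_eq (a21 i) _; rewrite /c; ring.
move=> x xl; apply/G; split.
- rewrite P22; move: x xl; apply/I22; split=> // i; have [[h _ _] [h' _ _]] := sites i.
    by apply: eq_subr_eq (esym h') _; ring.
  by apply: eq_subr_eq (esym h) _; ring.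
- rewrite P12//; move: x xl; apply/I12; split=> [|i|i]; first by rewrite sym subrr.
    have [_ [_ h _]] := sites i.
    by apply: eq_subr_eq h _; rewrite /c; ring.
  have [[_ h _] _] := sites i.
  by apply: eq_subr_eq h _; rewrite /c; ring.
- rewrite P21//; move: x xl; apply/I21; split=> [|i|i]; first by rewrite syp subrr.
    have [_ [_ _ h]] := sites i.
    by apply: eq_subr_eq h _; rewrite /c; ring.
  have [[_ _ h] _] := sites i.
  by apply: eq_subr_eq h _; rewrite /c; ring.
Qed.

End Intertwining.

(** * From the generating equations to the Bäcklund transformation and back *)

(** The imaginary unit is an atom [ii] here: the factor - ii^2 is displayed first, so that [field]
    needs no relation for it, and is then replaced by 1. *)
Lemma generated_site_z (K : numFieldType) (ii w Y k z : K) :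
  ii * ii = -1 -> w != 0 -> z != 0 ->
  ii * z * (- (ii / (2 * w)) * Y - ii * (k / z)) = Y / (2 * w) * z + k.
Proof.
move=> iiE w0 z0; transitivity (- (ii * ii) * (Y / (2 * w) * z + k)).
  by field; rewrite w0 z0.
by rewrite iiE opprK mul1r.
Qed.

Lemma generated_site_y (K : numFieldType) (ii w Y k y z z' r d m : K) :
  ii * ii = -1 -> w != 0 -> z != 0 -> k != 0 ->
  ii * z * (- ii * (d * z' / (2 * k) * (y / z + r) - k * y / z ^+ 2)
            - ii * m / (k * z))
    + ii * y * (- (ii / (2 * w)) * Y - ii * (k / z)) =
  Y / (2 * w) * y + (m / k + d * z * z' / (2 * k) * (y / z + r)).
Proof.
move=> iiE w0 z0 k0.
transitivity (- (ii * ii) * (Y / (2 * w) * y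
  + (m / k + d * z * z' / (2 * k) * (y / z + r)))).
  by field; rewrite w0 z0 k0.
by rewrite iiE opprK mul1r.
Qed.

Theorem proposition6p1 (R : realType) (N : nat) (lambda : 'I_N -> Cplx R)
    (w eta : Cplx R) (ell : 'I_N -> Cplx R) (v v' : chain_vars R N)
    (hN : (1 <= N)%N)
    (hlambda : injective lambda)
    (hw : w != 0)
    (heta : forall i, eta != lambda i)
    (hv : casimir ell v)
    (hv' : casimir ell v')
    (hzm : forall i, zm v i != 0)
    (hzp' : forall i, zp v' i != 0)
    (hk : forall i, 1 + (eta - lambda i) * zm v i * zp v' i != 0) :
  backlund w lambda eta v v' <->
  exists s l : 'I_N -> Cplx R -> Cplx R,
    let a i := k_arg lambda eta (zm v) (zp v') i in
    let k i := s i (a i) in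
    [/\ forall i, sqrt_branch (s i) (a i),
        forall i, log_branch (l i) ((1 + k i) / (1 - k i))
      & generated_by (gen_fun w lambda eta ell s l) v v'].
Proof.
pose p := (\sum_(j < N) ym v j) / (2 * w); pose q := (\sum_(j < N) yp v' j) / (2 * w).
have w2 : 2 * w != 0 by rewrite mulf_neq0// pnatr_eq0.
have ii : 'i * 'i = -1 :> Cplx R by rewrite -expr2 sqrCi.
(* The solution c of the second quadratic site relation for given nonzero k, written in the form
   that the z-derivatives of the generating function produce. *)
pose c k i := ell i / k + (eta - lambda i) * zm v i * zp v' i / (2 * k) *
  (ym v i / zm v i + (yp v' i / zp v' i - (eta - lambda i)^-1)).
have d0 i : eta - lambda i != 0 by rewrite subr_eq0.
have cE k i : k != 0 -> 2 * (k * c k i) = 2 * ell i +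
    (eta - lambda i) * (ym v i * zp v' i + yp v' i * zm v i) - zm v i * zp v' i.
  by move=> k0; rewrite /c; field; rewrite k0 hzm hzp' d0.
(* For any branches, the generating equations are exactly the parametrised site equations with these
   p, q and c; the logarithm enters only through its derivative. *)
have genP s l : (forall i, sqrt_branch (s i) (k_arg lambda eta (zm v) (zp v') i)) ->
    (forall i, log_branch (l i)
      ((1 + s i (k_arg lambda eta (zm v) (zp v') i)) /
       (1 - s i (k_arg lambda eta (zm v) (zp v') i)))) ->
    generated_by (gen_fun w lambda eta ell s l) v v' <->
    forall i, let k := s i (k_arg lambda eta (zm v) (zp v') i) in
      [/\ z3 v i = q * zm v i + k, y3 v i = q * ym v i + c k i,
          z3 v' i = p * zp v' i + k & y3 v' i = p * yp v' i + c k i].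
  move=> sP lP; rewrite /generated_by.
  split=> h i; have := h i; have k0 := k_neq0 hk sP i;
    rewrite partial_gen_fun_ym partial_gen_fun_yp partial_gen_fun_zm//
      partial_gen_fun_zp// !generated_site_z// !generated_site_y// -/p -/q;
    set k := s i _; rewrite -/k in k0.
  - suff -> : c k i = ell i / k + (eta - lambda i) * zp v' i * zm v i / (2 * k) *
        (yp v' i / zp v' i + (ym v i / zm v i - (eta - lambda i)^-1)).
      by case=> -> -> -> ->; split=> //; rewrite /c; ring.
    by rewrite /c; ring.
  - case=> -> -> -> ->; split=> //; rewrite /c; ring.
rewrite (backlundP _ _ _ _ hlambda); split.
  move=> [p' [q' [symE sypE sites]]].
  have p'E : p' = p by rewrite /p symE mulrC mulKf.
  have q'E : q' = q by rewrite /q sypE mulrC mulKf.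
  rewrite p'E q'E in sites.
  have /choice[k kP] : forall i, exists k : Cplx R,
      [/\ k ^+ 2 = 1 + (eta - lambda i) * zm v i * zp v' i, k != 0 &
       [/\ z3 v i = q * zm v i + k, y3 v i = q * ym v i + c k i,
          z3 v' i = p * zp v' i + k & y3 v' i = p * yp v' i + c k i]].
    move=> i; have [hyz hz] := hv i; have [hyz' hz'] := hv' i.
    have [k [b [[kk z3E z3'E] [kb y3E y3'E]]]] :=
      (site_eqsP p q (eta - lambda i) hyz hz hyz' hz' (hzm i) (hzp' i)).1 (sites i).
    (* Nonvanishing of k makes the relation for 2kc determine c, and keeps the square root away from
       its branch point. *)
    have k0 : k != 0 by rewrite -sqrf_eq0 kk.
    have bE : b = c k i.
      by apply: (mulfI k0); apply: (@mulfI _ 2); rewrite ?pnatr_eq0// cE.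
    by exists k; rewrite -bE.
  have /choice[s sP] : forall i, exists s : Cplx R -> Cplx R,
      sqrt_branch s (k_arg lambda eta (zm v) (zp v') i) /\
      s (k_arg lambda eta (zm v) (zp v') i) = k i.
    move=> i; have [kk k0 _] := kP i.
    by have [s sb sk] := sqrt_branch_exists k0 kk; exists s.
  have /choice[l lP] : forall i, exists l : Cplx R -> Cplx R,
      log_branch l ((1 + k i) / (1 - k i)).
    move=> i; apply: log_branch_exists; have [kk k0 _] := kP i.
    (* Since 1 - k^2 = - (eta - lambda_i) z_i^- z~_i^+ is nonzero, the argument of the logarithm is
       neither zero nor infinite. *)
    have : (1 - k i) * (1 + k i) != 0.
      have -> : (1 - k i) * (1 + k i) = - ((eta - lambda i) * zm v i * zp v' i).
        by transitivity (1 - k i ^+ 2); [ring | rewrite kk; ring].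
      by rewrite oppr_eq0 !mulf_neq0.
    by rewrite mulf_eq0 negb_or => /andP[km kp]; rewrite mulf_neq0// invr_eq0.
  have sk i : s i (k_arg lambda eta (zm v) (zp v') i) = k i by case: (sP i).
  exists s, l; split=> [i|i|]; [by case: (sP i) | by rewrite sk |].
  apply/genP => i; [by case: (sP i) | by rewrite sk |].
  by rewrite /= sk; case: (kP i).
move=> [s [l [sP lP /(genP s l sP lP) gen]]]; exists p, q; split=> [||i].
- by rewrite /p mulrC divfK.
- by rewrite /q mulrC divfK.
have [hyz hz] := hv i; have [hyz' hz'] := hv' i.
apply/(site_eqsP p q (eta - lambda i) hyz hz hyz' hz' (hzm i) (hzp' i)).
have [z3E y3E z3'E y3'E] := gen i.
pose k := s i (k_arg lambda eta (zm v) (zp v') i); exists k, (c k i).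
split; split=> //; first exact: sqr_k sP i.
exact/cE/(k_neq0 hk sP).
Qed.
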